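(* Consider the second-order system $\Sigma$ with transfer function $W(s)=C(Ms^2+Ds+K)^{-1}B$. Let $S\in\mathbb{R}^{\nu\times\nu}$, $L\in\mathbb{R}^{1\times\nu}$ be such that $(L,S)$ is observable and $\sigma(S)\cap\Omega=\emptyset$, and let $\Pi\in\mathbb{R}^{n\times\nu}$ and $\Upsilon\in\mathbb{R}^{\nu\times n}$ be the unique solutions of $$M\Pi S^2+D\Pi S+K\Pi=BL,\qquad S^2\Upsilon M+S\Upsilon D+\Upsilon K=-L^\top C,$$ and suppose $\Upsilon\Pi$ is nonsingular. Set $\Pi^\dagger:=(\Upsilon\Pi)^{-1}\Upsilon$ and $\Upsilon^\dagger:=\Pi(\Upsilon\Pi)^{-1}$. Assume that the set $\widehat\Omega$ of poles of the reduced models below satisfies $\sigma(S)\cap\widehat\Omega=\emptyset$. Then: (1) A model $\widehat\Sigma_G$ that matches the moments of $W(s)$ and of $W'(s)$ at $\sigma(S)$ is given by $F_2=\Pi^\dagger M\Pi$, $F_1=\Pi^\dagger D\Pi$, $G=\Pi^\dagger B$. (2) A model $\widehat\Sigma_H$ that matches the moments of $W(s)$ and of $W'(s)$ at $\sigma(S)$ is given by $F_2=\Upsilon M\Upsilon^\dagger$, $F_1=\Upsilon D\Upsilon^\dagger$, $H=C\Upsilon^\dagger$. (3) The reduced models in (1) and (2) are equivalent.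
   Context: $\Sigma$ is the single-input single-output second-order system $M\ddot x+D\dot x+Kx=Bu$, $y=Cx$, with $M,D,K\in\mathbb{R}^{n\times n}$, $B\in\mathbb{R}^{n}$, $C\in\mathbb{R}^{1\times n}$; $\Omega=\{s\in\mathbb{C}:\det(Ms^2+Ds+K)=0\}$ is assumed to consist of $2n$ points counted with multiplicity; $\nu<n$; $W'=dW/ds$. Reduced models have the form $F_2\ddot\xi+F_1\dot\xi+F_0\xi=Gu$, $\psi=H\xi$, with $F_i\in\mathbb{R}^{\nu\times\nu}$, $G\in\mathbb{R}^{\nu}$, $H\in\mathbb{R}^{1\times\nu}$, transfer function $\widehat W(s)=H(F_2s^2+F_1s+F_0)^{-1}G$ and pole set $\widehat\Omega=\{s\in\mathbb{C}:\det(F_2s^2+F_1s+F_0)=0\}$, assumed to consist of $2\nu$ points counted with multiplicity. Family $\widehat\Sigma_G$ (parameters $F_1,F_2,G$): $F_0=GL-F_2S^2-F_1S$, $H=C\Pi$. Family $\widehat\Sigma_H$ (parameters $F_1,F_2,H$): $F_0=-L^\top H-S^2F_2-SF_1$, $G=\Upsilon B$. The $k$-moment of a transfer function $V$ at $s_\star$ is $\frac{(-1)^k}{k!}V^{(k)}(s_\star)$. A reduced model matches the moments of $W$ (respectively $W'$) at $\sigma(S)$ if for every eigenvalue $\lambda$ of $S$ of algebraic multiplicity $m$, the $k$-moments at $\lambda$, $k=0,\dots,m-1$, of $\widehat W$ and $W$ (respectively of $\widehat W'$ and $W'$) coincide. Two reduced models are equivalent if they are related by an invertible coordinate transformation $T$: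 $F_i'=TF_iT^{-1}$, $G'=TG$, $H'=HT^{-1}$. *)

(* Defs.v *)
(* MathComp / MathComp-Analysis. *)
From mathcomp Require Import all_boot all_order all_algebra complex.
From mathcomp Require Import all_classical all_reals all_analysis.
Import GRing.Theory Num.Theory numFieldNormedType.Exports.

Set Implicit Arguments.
Unset Strict Implicit.
Unset Printing Implicit Defensive.

Local Open Scope classical_set_scope.
Local Open Scope ring_scope.

(* SOSystem M D K B C is the system  M x'' + D x' + K x = B u,  y = C x.
   The arguments go from the second-order coefficient down to the zeroth. *)
Record sosystem (R : realType) (n : nat) := SOSystem {
  so_M : 'M[R]_n;
  so_D : 'M[R]_n;
  so_K : 'M[R]_n;
  so_B : 'cV[R]_n;
  so_C : 'rV[R]_n
}.

Definition cmx (R : realType) (m n : nat) (A : 'M[R]_(m, n)) : 'M[R[i]]_(m, n) :=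
  map_mx (real_complex R) A.

Definition pencil (R : realType) (n : nat) (Sg : sosystem R n) (s : R[i]) :
    'M[R[i]]_n :=
  s ^+ 2 *: cmx (so_M Sg) + s *: cmx (so_D Sg) + cmx (so_K Sg).

Definition transfer (R : realType) (n : nat) (Sg : sosystem R n) (s : R[i]) : R[i] :=
  (cmx (so_C Sg) *m invmx (pencil Sg s) *m cmx (so_B Sg)) 0 0.

Definition poles (R : realType) (n : nat) (Sg : sosystem R n) : set R[i] :=
  [set s | \det (pencil Sg s) = 0].

(* det(M s^2 + D s + K) as a polynomial in s: the multiplicity of a pole is its
   multiplicity as a root of this polynomial. *)
Definition pole_poly (R : realType) (n : nat) (Sg : sosystem R n) : {poly R[i]} :=
  \det ('X^2 *: map_mx polyC (cmx (so_M Sg)) + 'X *: map_mx polyC (cmx (so_D Sg))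
        + map_mx polyC (cmx (so_K Sg))).

Lemma horner_pole_poly (R : realType) (n : nat) (Sg : sosystem R n) (s : R[i]) :
  (pole_poly Sg).[s] = \det (pencil Sg s).
Proof.
rewrite /pole_poly -horner_evalE -det_map_mx; congr (\det _).
apply/matrixP => i j; rewrite !mxE /= /horner_eval.
by rewrite !(hornerD, hornerM, hornerXn, hornerX, hornerC).
Qed.

(* The pole set consists of N points counted with multiplicity. The condition
   pole_poly Sg != 0 is needed because mup z 0 = 0: without it a singular pencil,
   for which every point is a pole, would count as having no pole. *)
Definition pole_count (R : realType) (n : nat) (Sg : sosystem R n) (N : nat) : Prop :=
  pole_poly Sg != 0 /\
  exists rs : seq R[i],
    size rs = N /\ forall z, count_mem z rs = mup z (pole_poly Sg).

Definition spectrum (R : realType) (nu : nat) (S : 'M[R]_nu) : set R[i] :=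
  [set z | eigenvalue (cmx S) z].

(* Its rows are L, L S, ..., L S^(nu-1). *)
Definition observability_mx (R : realType) (nu : nat) (L : 'rV[R]_nu) (S : 'M[R]_nu) :
    'M[R]_nu :=
  \matrix_(i < nu) (L *m S ^+ i).

Definition observable (R : realType) (nu : nat) (L : 'rV[R]_nu) (S : 'M[R]_nu) : Prop :=
  \rank (observability_mx L S) = nu.

(* These are stated over a numFieldType K, used below with K := R[i], because the
   topology of MathComp-Analysis is attached to abstract numFieldTypes; for
   K := R[i] the derivatives are complex derivatives. *)
Definition derivative (K : numFieldType) (V : K -> K) : K -> K := derive1 V.

Definition moment (K : numFieldType) (V : K -> K) (k : nat) (s : K) : K :=
  (-1) ^+ k / (k`!)%:R * derive1n k V s.

Definition matches_moments (R : realType) (nu : nat) (S : 'M[R]_nu)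
    (V1 V2 : R[i] -> R[i]) : Prop :=
  forall (lambda : R[i]) (k : nat),
    lambda \in spectrum S -> (k < mup lambda (char_poly (cmx S)))%N ->
    moment V1 k lambda = moment V2 k lambda.

Definition family_G (R : realType) (n nu : nat) (Sg : sosystem R n)
    (S : 'M[R]_nu) (L : 'rV[R]_nu) (Pi : 'M[R]_(n, nu))
    (F1 F2 : 'M[R]_nu) (G : 'cV[R]_nu) : sosystem R nu :=
  SOSystem F2 F1 (G *m L - F2 *m S ^+ 2 - F1 *m S) G (so_C Sg *m Pi).

Definition family_H (R : realType) (n nu : nat) (Sg : sosystem R n)
    (S : 'M[R]_nu) (L : 'rV[R]_nu) (Ups : 'M[R]_(nu, n))
    (F1 F2 : 'M[R]_nu) (H : 'rV[R]_nu) : sosystem R nu :=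
  SOSystem F2 F1 (- (L^T *m H) - S ^+ 2 *m F2 - S *m F1) (Ups *m so_B Sg) H.

Definition equivalent (R : realType) (nu : nat) (Sg Sg' : sosystem R nu) : Prop :=
  exists T : 'M[R]_nu,
    [/\ T \in unitmx
      , so_M Sg' = T *m so_M Sg *m invmx T
      , so_D Sg' = T *m so_D Sg *m invmx T
      & so_K Sg' = T *m so_K Sg *m invmx T] /\
    so_B Sg' = T *m so_B Sg /\ so_C Sg' = so_C Sg *m invmx T.

(* Main.v *)
(** With P(s) = M s^2 + D s + K, the Sylvester equations turn both reduced models
    into Petrov-Galerkin projections: up to invertible factors on either side
    their pencil is Q(s) = Ups P(s) Pi, with input Ups B and output C Pi. Hence
    they are equivalent, and the error is W - W^ = C X B where
    X = P^-1 - Pi Q^-1 Ups satisfies X P Pi = 0 and Ups P X = 0. Therefore B may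
    be changed modulo the image of P Pi, and C modulo that of Ups P. Let a be an
    eigenvalue of S of multiplicity m. Observability provides a polynomial
    combination of the first kind which makes B vanish to order m at a; a left
    eigenvector w of S provides one of the second kind which makes C vanish to
    order 1, because w L^T = 0 would give w Ups P(a) = 0. So W - W^ vanishes to
    order m + 1 at a, which is exactly the matching of the first m moments of W
    and of W'. Denominators are avoided by working over polynomials with
    adjugates. *)
Require Import Defs.
From mathcomp Require Import all_boot all_order all_algebra complex.
From mathcomp Require Import all_classical all_reals all_analysis.
From mathcomp Require Import ring.
Import GRing.Theory Num.Theory numFieldNormedType.Exports.

Set Implicit Arguments.
Unset Strict Implicit.
Unset Printing Implicit Defensive.

Local Open Scope classical_set_scope.
Local Open Scope ring_scope.

(** * Derivatives and moments of ratios of polynomials *)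

Lemma is_derive_horner (K : numFieldType) (p : {poly K}) (x : K) :
  is_derive x 1 (fun s => p.[s]) p^`().[x].
Proof.
elim/poly_ind: p => [|p c IHp].
  rewrite deriv0 horner0 (_ : (fun s => _) = cst 0); first exact: is_derive_cst.
  by apply/funext => s /=; rewrite horner0.
have -> : (fun s => (p * 'X + c%:P).[s]) = (fun s => p.[s]) * id + cst c.
  by apply/funext => s; rewrite !fctE !hornerE.
have := is_deriveD (is_deriveM IHp (is_derive_id x 1)) (is_derive_cst c x 1).
move/is_derive_eq; apply.
rewrite derivD derivM derivX derivC /GRing.scale /= !hornerE /cst.
by ring.
Qed.

Lemma near_horner_neq0 (K : numFieldType) (q : {poly K}) (a : K) :
  q.[a] != 0 -> \forall s \near a, q.[s] != 0.
Proof.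
move=> qa; have cq : (fun s => q.[s]) @ a --> q.[a]; last exact: (cvgr_neq0 _ cq).
apply: differentiable_continuous; apply/derivable1_diffP.
by have [] := is_derive_horner q a.
Qed.

(** The formula for [f] is required only off the zeros of [q], because [transfer] takes a junk value
    at a pole. As [q] stays nonzero near [a], this determines [f] near [a]. *)
Lemma derive1_ratio (K : numFieldType) (f : K -> K) (p q : {poly K}) (a : K) :
  (forall s, q.[s] != 0 -> f s = p.[s] / q.[s]) -> q.[a] != 0 ->
  derive1 f a = (p^`() * q - p * q^`()).[a] / (q ^+ 2).[a].
Proof.
move=> fE qa; rewrite derive1E.
have dp := is_derive_horner p a; have dq := is_derive_horner q a.
rewrite (@near_eq_derive _ _ _ f ((fun s => p.[s]) * (fun s => (q.[s])^-1))).
  rewrite deriveM ?deriveV //; last exact: derivableV.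
  rewrite !derive_val /GRing.scale /= !(hornerD, hornerN, hornerM, horner_exp).
  by field.
by apply: filterS (near_horner_neq0 qa) => s /fE ->.
Qed.

Lemma dvdp_deriv_exp (K : fieldType) (d p : {poly K}) (N : nat) :
  d ^+ N.+1 %| p -> d ^+ N %| p^`().
Proof.
case/dvdpP => c ->; rewrite derivM deriv_exp /= dvdp_add //.
  by rewrite dvdp_mull // exprS dvdp_mulIr.
by rewrite dvdp_mull // -mulr_natr dvdp_mulr // dvdp_mull.
Qed.

(** Differentiation squares the denominators and sends the cross difference Delta to Delta' q1 q2 -
    Delta (q1 q2)', so each derivative costs one order of vanishing at [a]. *)
Lemma derive1n_ratio_eq (K : numFieldType) (a : K) (k N : nat)
    (f1 f2 : K -> K) (p1 q1 p2 q2 : {poly K}) :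
  (forall s, q1.[s] != 0 -> f1 s = p1.[s] / q1.[s]) -> q1.[a] != 0 ->
  (forall s, q2.[s] != 0 -> f2 s = p2.[s] / q2.[s]) -> q2.[a] != 0 ->
  ('X - a%:P) ^+ N %| p1 * q2 - p2 * q1 -> (k < N)%N ->
  derive1n k f1 a = derive1n k f2 a.
Proof.
elim: k N f1 f2 p1 q1 p2 q2 => [|k IHk] N f1 f2 p1 q1 p2 q2 f1E q1a f2E q2a.
  move=> dvd N_gt0; rewrite !derive1n0 f1E // f2E //.
  have : root (p1 * q2 - p2 * q1) a.
    by rewrite -dvdp_XsubCl (dvdp_trans _ dvd) // dvdp_exp.
  rewrite rootE !hornerE subr_eq0 => /eqP e.
  by apply/eqP; rewrite eqr_div // e.
case: N => // N dvd ltkN; rewrite !derive1Sn.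
apply: (IHk N _ _ (p1^`() * q1 - p1 * q1^`()) (q1 ^+ 2)
                 (p2^`() * q2 - p2 * q2^`()) (q2 ^+ 2)) => //.
- move=> s qs; apply: derive1_ratio => //.
  by apply: contraNneq qs => qs0; rewrite horner_exp qs0 expr0n.
- by rewrite horner_exp expf_eq0.
- move=> s qs; apply: derive1_ratio => //.
  by apply: contraNneq qs => qs0; rewrite horner_exp qs0 expr0n.
- by rewrite horner_exp expf_eq0.
set Delta := p1 * q2 - p2 * q1.
have -> : (p1^`() * q1 - p1 * q1^`()) * q2 ^+ 2 -
          (p2^`() * q2 - p2 * q2^`()) * q1 ^+ 2 =
          Delta^`() * (q1 * q2) - Delta * (q1 * q2)^`().
  by rewrite /Delta derivB !derivM; ring.
rewrite dvdp_sub // dvdp_mulr ?dvdp_deriv_exp //.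
by apply: dvdp_trans dvd; rewrite dvdp_exp2l.
Qed.

(** The order is m + 1 and not m because the k-moment of f' involves the derivative of order k + 1
    of f. *)
Lemma moment_ratio_eq (K : numFieldType) (a : K) (k m : nat)
    (f1 f2 : K -> K) (p1 q1 p2 q2 : {poly K}) :
  (forall s, q1.[s] != 0 -> f1 s = p1.[s] / q1.[s]) -> q1.[a] != 0 ->
  (forall s, q2.[s] != 0 -> f2 s = p2.[s] / q2.[s]) -> q2.[a] != 0 ->
  ('X - a%:P) ^+ m.+1 %| p1 * q2 - p2 * q1 -> (k < m)%N ->
  moment f1 k a = moment f2 k a /\
  moment (derivative f1) k a = moment (derivative f2) k a.
Proof.
move=> f1E q1a f2E q2a dvd ltkm.
have eqD j := derive1n_ratio_eq (k := j) f1E q1a f2E q2a dvd.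
by rewrite /moment /derivative -!derive1Sn !eqD ?ltnS // ltnW // ltnS ltnW.
Qed.

(** * Error of a Petrov-Galerkin projection *)

(* With X = P^-1 - Pi Q^-1 Ups, the parenthesis is det P * det Q * (C X B). *)
Lemma tangential_defect (R : comNzRingType) (n k : nat) (P : 'M[R]_n)
    (Pi : 'M[R]_(n, k)) (Ups : 'M[R]_(k, n)) (B : 'cV[R]_n) (C : 'rV[R]_n)
    (a b c d : R) (v : 'cV[R]_k) (w : 'rV[R]_k) (u : 'cV[R]_n) (r : 'rV[R]_n) :
  let Q := Ups *m P *m Pi in
  c *: B - P *m Pi *m v = a *: u ->
  d *: C + w *m Ups *m P = b *: r ->
  exists z,
    d * c * ((C *m \adj P *m B) 0 0 * \det Q
             - (C *m Pi *m \adj Q *m (Ups *m B)) 0 0 * \det P) = b * a * z.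
Proof.
move=> Q eB eC.
(* P^-1 - Pi Q^-1 Ups cleared of denominators, so that both annihilation identities hold over any
   commutative ring. *)
pose X := \det Q *: \adj P - \det P *: (Pi *m \adj Q *m Ups).
have XP0 : X *m P *m Pi = 0.
  rewrite /X !mulmxBl -!scalemxAl mul_adj_mx.
  have -> : Pi *m \adj Q *m Ups *m P *m Pi = Pi *m (\adj Q *m Q).
    by rewrite /Q !mulmxA.
  by rewrite mul_adj_mx mul_scalar_mx mul_mx_scalar !scalerA mulrC subrr.
have PX0 : Ups *m P *m X = 0.
  rewrite /X mulmxBr -!scalemxAr -(mulmxA Ups P) mul_mx_adj.
  have -> : Ups *m P *m (Pi *m \adj Q *m Ups) = Q *m \adj Q *m Ups.
    by rewrite /Q !mulmxA.
  by rewrite mul_mx_adj mul_scalar_mx mul_mx_scalar !scalerA mulrC subrr.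
exists ((r *m X *m u) 0 0).
(* Around X, the two identities allow d C and c B to be replaced by b r and a u. *)
transitivity (((d *: C) *m X *m (c *: B)) 0 0).
  rewrite /X -!scalemxAl -scalemxAr mulmxBr mulmxBl -!scalemxAr -!scalemxAl.
  by rewrite !mulmxA !mxE; ring.
have -> : d *: C = b *: r - w *m Ups *m P by rewrite -eC addrK.
have -> : c *: B = a *: u + P *m Pi *m v by rewrite -eB subrK.
rewrite mulmxBl -[w *m Ups *m P]mulmxA -[w *m _ *m X]mulmxA PX0 mulmx0 subr0.
rewrite mulmxDr -!scalemxAl !mulmxA.
have -> : r *m X *m P *m Pi = r *m (X *m P *m Pi) by rewrite !mulmxA.
by rewrite XP0 mulmx0 mul0mx scaler0 addr0 -scalemxAr !mxE; ring.
Qed.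

(** * Sylvester equations as division by t - S *)

(** Right division of P(t) Pi by t - S: the remainder, got by putting S for t to the right of the
    coefficients, is [E] by the Sylvester equation. *)
Lemma sylvester_right (R : comNzRingType) (n k : nat) (t : R) (M D K : 'M[R]_n)
    (S : 'M[R]_k) (Pi : 'M[R]_(n, k)) (E : 'M[R]_(n, k)) :
  M *m Pi *m (S *m S) + D *m Pi *m S + K *m Pi = E ->
  (t ^+ 2 *: M + t *: D + K) *m Pi - E =
    (t *: (M *m Pi) + M *m Pi *m S + D *m Pi) *m (t%:M - S).
Proof.
move=> <-; rewrite !(mulmxBr, mulmxDl) !mul_mx_scalar -!scalemxAl.
(* The products are generalized so that [mxE] does not expand them into sums. *)
rewrite scalerA expr2 !mulmxA; move: (M *m Pi *m S) (M *m Pi *m S *m S) => A1 A2.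
move: (M *m Pi) (D *m Pi) (K *m Pi) (D *m Pi *m S) => A3 A4 A5 A6.
by apply/matrixP => i j; rewrite !mxE; ring.
Qed.

Lemma sylvester_left (R : comNzRingType) (n k : nat) (t : R) (M D K : 'M[R]_n)
    (S : 'M[R]_k) (Ups : 'M[R]_(k, n)) (E : 'M[R]_(k, n)) :
  (S *m S) *m Ups *m M + S *m Ups *m D + Ups *m K = - E ->
  Ups *m (t ^+ 2 *: M + t *: D + K) + E =
    (t%:M - S) *m (t *: (Ups *m M) + S *m Ups *m M + Ups *m D).
Proof.
move=> /esym/eqP; rewrite eqr_oppLR => /eqP ->.
rewrite !(mulmxBl, mulmxDr) !mul_scalar_mx -!scalemxAr scalerA expr2 !mulmxA.
move: (S *m Ups *m M) (S *m S *m Ups *m M) => A1 A2.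
move: (Ups *m M) (Ups *m D) (Ups *m K) (S *m Ups *m D) => A3 A4 A5 A6.
by apply/matrixP => i j; rewrite !mxE; ring.
Qed.

(** * Observability and polynomial tangent vectors *)

Lemma map_mx_horner_polyC (F : comNzRingType) (m n : nat) (s : F)
    (A : 'M[F]_(m, n)) :
  map_mx (horner_eval s) (map_mx polyC A) = A.
Proof. by apply/matrixP => i j; rewrite !mxE /= /horner_eval hornerC. Qed.

Lemma row_horner_mx (F : fieldType) (k : nat) (L : 'rV[F]_k.+1) (S : 'M[F]_k.+1)
    (p : {poly F}) :
  (size p <= k.+1)%N ->
  L *m horner_mx S p =
    (\row_i p`_i) *m (\matrix_(i < k.+1) (L *m S ^+ i)).
Proof.
move=> szp; rewrite [RHS]mulmx_sum_row -{1}[p]coefK poly_def.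
rewrite (big_ord_widen _ (fun i => p`_i *: 'X^i) szp) big_mkcond /=.
rewrite rmorph_sum mulmx_sumr; apply: eq_bigr => i _.
rewrite rowK mxE; case: ltnP => [_|lei].
  by rewrite /= horner_mxZ rmorphXn /= horner_mx_X -scalemxAr.
by rewrite rmorph0 mulmx0 nth_default // scale0r.
Qed.

Lemma row_horner_mx_neq0 (F : fieldType) (k : nat) (L : 'rV[F]_k.+1)
    (S : 'M[F]_k.+1) (p : {poly F}) :
  row_free (\matrix_(i < k.+1) (L *m S ^+ i)) -> p != 0 -> (size p <= k.+1)%N ->
  L *m horner_mx S p != 0.
Proof.
move=> obs p0 szp; rewrite row_horner_mx // mulmx_free_eq0 //.
apply: contra_neq p0 => /rowP e; apply/polyP => i; rewrite coef0.
have [lti|lei] := ltnP i (size p); last by rewrite nth_default.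
by have := e (Ordinal (leq_trans lti szp)); rewrite !mxE.
Qed.

(** Take v = (X - a)^m (X - S)^-1 psi(S) v0 with char_poly S = psi (X - a)^m. It is polynomial since
    (S - a)^m psi(S) = 0 by Cayley-Hamilton. Its value at a is (S - a)^(m-1) psi(S) v0 = p(S) v0,
    and v0 is chosen so that L p(S) v0 is nonzero. *)
Lemma observable_tangent (F : fieldType) (k : nat) (L : 'rV[F]_k) (S : 'M[F]_k)
    (a : F) (m := mup a (char_poly S)) :
  row_free (\matrix_(i < k) (L *m S ^+ i)) -> eigenvalue S a ->
  exists v u : 'cV[{poly F}]_k,
    char_poly_mx S *m v = ('X - a%:P) ^+ m *: u /\
    ((map_mx polyC L *m v) 0 0).[a] != 0.
Proof.
(* [horner_mx] needs a positive size; in size 0 there is no eigenvector. *)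
case: k L S @m => [|k] L S m obs.
  by case/eigenvalueP => w _; rewrite [w]thinmx0 eqxx.
rewrite eigenvalue_root_char -dvdp_XsubCl => dvd.
have chi0 : char_poly S != 0 by rewrite monic_neq0 // char_poly_monic.
have m_gt0 : (0 < m)%N by rewrite /m -XsubC_dvd.
have /dvdpP[psi chiE] : ('X - a%:P) ^+ m %| char_poly S by rewrite -mup_geq.
have psi0 : psi != 0 by apply: contra_neq chi0 => psi0; rewrite chiE psi0 mul0r.
(* p = char_poly S / (X - a) has degree k, too small for L p(S) to vanish. *)
pose p := ('X - a%:P) ^+ m.-1 * psi.
have p0 : p != 0 by rewrite mulf_neq0 // expf_neq0 // polyXsubC_eq0.
have szp : (size p <= k.+1)%N.
  have chipE : char_poly S = p * ('X - a%:P).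
    by rewrite chiE /p mulrAC -exprSr (prednK m_gt0) mulrC.
  have := size_char_poly S.
  by rewrite chipE size_Mmonic ?monicXsubC // size_XsubC addn2 /= => -[->].
have [j Lpj] : exists j, (L *m horner_mx S p) 0 j != 0.
  by apply/rV0Pn; exact: row_horner_mx_neq0.
pose v0 : 'cV[F]_k.+1 := delta_mx j 0.
pose x : 'M[{poly F}]_k.+1 := ('X - a%:P)%:M.
pose y := map_mx polyC (S - a%:M).
have cxy : GRing.comm x y by apply: esym; exact: comm_mx_scalar.
(* T is the quotient of x^m - y^m by x - y = X - S. *)
pose T := \sum_(i < m) x ^+ (m.-1 - i) * y ^+ i.
have xyT : char_poly_mx S *m T = x ^+ m - y ^+ m.
  rewrite subrXX_comm // -mulmxE; congr (_ *m _).
    rewrite /x /y /char_poly_mx map_mxB map_scalar_mx /= raddfB /=.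
    by rewrite opprB addrA subrK.
have hS (q : {poly F}) i : horner_mx S (('X - a%:P) ^+ i * q) =
    (S - a%:M) ^+ i * horner_mx S q.
  by rewrite rmorphM rmorphXn rmorphB /= horner_mx_X horner_mx_C.
exists (T *m map_mx polyC (horner_mx S psi *m v0)),
  (map_mx polyC (horner_mx S psi *m v0)); split.
  rewrite mulmxA xyT mulmxBl {2}map_mxM mulmxA.
  have -> : y ^+ m *m map_mx polyC (horner_mx S psi) = 0.
    rewrite mulmxE -rmorphXn -rmorphM -hS mulrC -chiE Cayley_Hamilton.
    by rewrite rmorph0.
  by rewrite mul0mx subr0 /x -rmorphXn /= mul_scalar_mx.
(* At [a] every summand with i < m - 1 keeps a positive power of X - a and vanishes. *)
have Ta : map_mx (horner_eval a) T = (S - a%:M) ^+ m.-1.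
  rewrite /T rmorph_sum /= -(prednK m_gt0) big_ord_recr /= subnn expr0 mul1r.
  rewrite big1 ?add0r; last first.
    move=> i _; rewrite rmorphM rmorphXn /= map_scalar_mx /= /horner_eval.
    rewrite hornerXsubC subrr raddf0 expr0n subn_eq0 leqNgt ltn_ord /=.
    by rewrite mul0r.
  by rewrite rmorphXn /= map_mx_horner_polyC.
set A := _ *m _.
have -> : (A 0 0).[a] = (map_mx (horner_eval a) A) 0 0 by rewrite [RHS]mxE.
rewrite /A map_mxM [map_mx _ (T *m _)]map_mxM Ta !map_mx_horner_polyC mulmxA.
have -> : L *m (S - a%:M) ^+ m.-1 *m (horner_mx S psi *m v0) =
          L *m horner_mx S p *m v0.
  by rewrite hS -!mulmxA mulmxA.
by rewrite -colE mxE.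
Qed.

(** * Projections of second-order systems *)

(** With square invertible [U] and [V] this also expresses changes of coordinates, so that
    projection and equivalence share one definition. *)
Definition galerkin (R : realType) (n k : nat) (Sg : sosystem R n)
    (U : 'M[R]_(k, n)) (V : 'M[R]_(n, k)) : sosystem R k :=
  SOSystem (U *m so_M Sg *m V) (U *m so_D Sg *m V) (U *m so_K Sg *m V)
           (U *m so_B Sg) (so_C Sg *m V).

Definition pencil_mx (R : realType) (n : nat) (Sg : sosystem R n) :
    'M[{poly R[i]}]_n :=
  'X^2 *: map_mx polyC (cmx (so_M Sg)) + 'X *: map_mx polyC (cmx (so_D Sg))
  + map_mx polyC (cmx (so_K Sg)).

Definition transfer_num (R : realType) (n : nat) (Sg : sosystem R n) :
    {poly R[i]} :=
  (map_mx polyC (cmx (so_C Sg)) *m \adj (pencil_mx Sg)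
   *m map_mx polyC (cmx (so_B Sg))) 0 0.

Section Systems.
Variables (R : realType).

Lemma horner_pencil_mx (n : nat) (Sg : sosystem R n) (s : R[i]) :
  map_mx (horner_eval s) (pencil_mx Sg) = pencil Sg s.
Proof.
by apply/matrixP => i j; rewrite !mxE /= /horner_eval !(hornerE, hornerXn).
Qed.

Lemma transfer_ratio (n : nat) (Sg : sosystem R n) (s : R[i]) :
  (pole_poly Sg).[s] != 0 ->
  transfer Sg s = (transfer_num Sg).[s] / (pole_poly Sg).[s].
Proof.
rewrite horner_pole_poly => det0.
have -> : (transfer_num Sg).[s] =
  (map_mx (horner_eval s) (map_mx polyC (cmx (so_C Sg)) *m \adj (pencil_mx Sg)
   *m map_mx polyC (cmx (so_B Sg)))) 0 0 by rewrite [RHS]mxE.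
rewrite !map_mxM map_mx_adj horner_pencil_mx !map_mx_horner_polyC.
rewrite /transfer /invmx unitmxE unitfE det0.
by rewrite -scalemxAr -scalemxAl mxE mulrC.
Qed.

Lemma pencil_galerkin (n k : nat) (Sg : sosystem R n) (U : 'M[R]_(k, n))
    (V : 'M[R]_(n, k)) (s : R[i]) :
  pencil (galerkin Sg U V) s = cmx U *m pencil Sg s *m cmx V.
Proof.
by rewrite /pencil /cmx /= !map_mxM !(mulmxDr, mulmxDl) -!scalemxAr -!scalemxAl.
Qed.

Lemma pencil_mx_galerkin (n k : nat) (Sg : sosystem R n) (U : 'M[R]_(k, n))
    (V : 'M[R]_(n, k)) :
  pencil_mx (galerkin Sg U V) =
    map_mx polyC (cmx U) *m pencil_mx Sg *m map_mx polyC (cmx V).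
Proof.
rewrite /pencil_mx /cmx /= !map_mxM !(mulmxDr, mulmxDl) -!scalemxAr.
by rewrite -!scalemxAl.
Qed.

(** [U] and [V] cancel against the inverse of the pencil. At a pole this breaks down, as [invmx]
    returns a singular matrix unchanged. *)
Lemma transfer_galerkin_unit (n : nat) (Sg : sosystem R n) (U V : 'M[R]_n)
    (s : R[i]) :
  U \in unitmx -> V \in unitmx -> pencil Sg s \in unitmx ->
  transfer (galerkin Sg U V) s = transfer Sg s.
Proof.
move=> Uu Vu Pu; rewrite /transfer pencil_galerkin /=.
have cu (A : 'M[R]_n) : A \in unitmx -> cmx A \in unitmx by rewrite map_unitmx.
have -> : invmx (cmx U *m pencil Sg s *m cmx V) =
    invmx (cmx V) *m invmx (pencil Sg s) *m invmx (cmx U).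
  apply: (can_inj (mulKmx (_ : cmx U *m pencil Sg s *m cmx V \in unitmx))).
    by rewrite !unitmx_mul !cu ?Pu.
  rewrite mulmxV ?unitmx_mul ?cu ?Pu // !mulmxA mulmxK ?cu // mulmxK //.
  by rewrite mulmxV ?cu.
rewrite /cmx !map_mxM -!/(cmx _) !mulmxA mulmxK ?cu // -!mulmxA.
by rewrite (mulKmx (cu _ Uu)).
Qed.

Lemma pole_poly_galerkin (n : nat) (Sg : sosystem R n) (U V : 'M[R]_n)
    (s : R[i]) :
  (pole_poly (galerkin Sg U V)).[s] != 0 -> (pole_poly Sg).[s] != 0.
Proof.
rewrite !horner_pole_poly pencil_galerkin !det_mulmx.
by apply: contra_neq => ->; rewrite mulr0 mul0r.
Qed.

(** Rank is unchanged by extending scalars from R to R[i]. *)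
Lemma observable_cmx (k : nat) (L : 'rV[R]_k) (S : 'M[R]_k) :
  observable L S -> row_free (\matrix_(i < k) (cmx L *m cmx S ^+ i)).
Proof.
move=> obs; have : row_free (cmx (observability_mx L S)).
  by rewrite row_free_map /row_free; apply/eqP.
congr (is_true (row_free _)); apply/row_matrixP => i.
rewrite rowK /cmx -map_row rowK map_mxM; congr (_ *m _).
move: (nat_of_ord i) => j; clear; elim: j => [|j IHj].
  by rewrite !expr0 map_mx1.
by rewrite !exprS -IHj [LHS]map_mxM.
Qed.

(** * Two-sided interpolation at the eigenvalues of S *)

Section TwoSided.
Variables (n k : nat) (Sg : sosystem R n) (S : 'M[R]_k) (L : 'rV[R]_k).
Variables (Pi : 'M[R]_(n, k)) (Ups : 'M[R]_(k, n)).
Hypothesis obs : observable L S.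
Hypothesis sylvPi : so_M Sg *m Pi *m S ^+ 2 + so_D Sg *m Pi *m S + so_K Sg *m Pi =
  so_B Sg *m L.
Hypothesis sylvUps :
  S ^+ 2 *m Ups *m so_M Sg + S *m Ups *m so_D Sg + Ups *m so_K Sg =
  - (L^T *m so_C Sg).
Hypothesis UPu : Ups *m Pi \in unitmx.

Local Notation polycmx A := (map_mx polyC (cmx A)).

(** The Sylvester equation reads P Pi = B L + N (X - S). Applied to the v of [observable_tangent] it
    gives P Pi v = (L v) B + (X - a)^m N u, whence c = L v. *)
Lemma right_tangent (a : R[i]) : a \in spectrum S ->
  exists c v u, c.[a] != 0 /\
    c *: polycmx (so_B Sg) - pencil_mx Sg *m polycmx Pi *m v =
    ('X - a%:P) ^+ mup a (char_poly (cmx S)) *: u.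
Proof.
rewrite inE => Sa.
have [v [u [Sv Lv]]] := observable_tangent (observable_cmx obs) Sa.
exists ((polycmx L *m v) 0 0), v.
pose N := 'X *: (polycmx (so_M Sg) *m polycmx Pi) +
  polycmx (so_M Sg) *m polycmx Pi *m polycmx S + polycmx (so_D Sg) *m polycmx Pi.
exists (- (N *m u)); split=> //.
have /(congr1 (fun A => polycmx A)) := sylvPi.
rewrite (_ : S ^+ 2 = S *m S) // /cmx !map_mxD !map_mxM -/(cmx _).
move/(sylvester_right 'X) => e.
have -> : (polycmx L *m v) 0 0 *: polycmx (so_B Sg) =
    polycmx (so_B Sg) *m polycmx L *m v.
  by rewrite -mulmxA [polycmx L *m v]mx11_scalar mul_mx_scalar mxE mulr1n.
rewrite -opprB -mulmxBl e -/N -/(char_poly_mx (cmx S)) -(mulmxA N) Sv.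
by rewrite scalerN -scalemxAr.
Qed.

(** A constant left eigenvector w satisfies w (X - S) = (X - a) w, so the Sylvester equation for
    [Ups] gives order 1 with d = w L^T. *)
Lemma left_tangent (a : R[i]) : a \in spectrum S -> pencil Sg a \in unitmx ->
  exists d w r, d.[a] != 0 /\
    d *: polycmx (so_C Sg) + w *m polycmx Ups *m pencil_mx Sg = ('X - a%:P) *: r.
Proof.
rewrite inE => /eigenvalueP[w wS w0] Pu.
have /(congr1 (fun A => polycmx A)) := sylvUps.
rewrite (_ : S ^+ 2 = S *m S) // /cmx map_mxN !map_mxN !map_mxD !map_mxM -/(cmx _).
move/(sylvester_left 'X).
set N := _ + polycmx S *m _ *m _ + _ => e.
pose wP := map_mx polyC w.
have e' : (wP *m polycmx L^T) 0 0 *: polycmx (so_C Sg) +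
    wP *m polycmx Ups *m pencil_mx Sg = ('X - a%:P) *: (wP *m N).
  have -> : (wP *m polycmx L^T) 0 0 *: polycmx (so_C Sg) =
      wP *m (polycmx L^T *m polycmx (so_C Sg)).
    by rewrite mulmxA [wP *m polycmx L^T]mx11_scalar mul_scalar_mx mxE mulr1n.
  rewrite addrC -(mulmxA wP) -mulmxDr e mulmxA scalemxAl; congr (_ *m _).
  rewrite mulmxBr mul_mx_scalar -map_mxM wS scalerBl; congr (_ - _).
  exact: map_mxZ.
exists ((wP *m polycmx L^T) 0 0), wP, (wP *m N); split=> //.
(* If d vanished at a, then w Ups P(a) = 0; cancelling P(a) and then Ups Pi would give w = 0. *)
apply: contra_neq w0 => d0.
have : map_mx (horner_eval a) (wP *m polycmx Ups *m pencil_mx Sg) = 0.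
  rewrite -[X in map_mx _ X](addKr ((wP *m polycmx L^T) 0 0 *: polycmx (so_C Sg))).
  rewrite e' map_mxD map_mxN !map_mxZ /= /horner_eval d0 hornerXsubC subrr.
  by rewrite !scale0r oppr0 addr0.
rewrite !map_mxM horner_pencil_mx !map_mx_horner_polyC.
move/(congr1 (mulmx^~ (invmx (pencil Sg a)))); rewrite mulmxK // mul0mx.
move/(congr1 (mulmx^~ (cmx Pi))); rewrite mul0mx -mulmxA -map_mxM.
move/(congr1 (mulmx^~ (invmx (cmx (Ups *m Pi))))).
by rewrite mulmxK ?map_unitmx // mul0mx.
Qed.

Lemma transfer_diff_dvdp (a : R[i]) (Sr := galerkin Sg Ups Pi) :
  a \in spectrum S -> (pole_poly Sg).[a] != 0 ->
  ('X - a%:P) ^+ (mup a (char_poly (cmx S))).+1 %|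
    transfer_num Sr * pole_poly Sg - transfer_num Sg * pole_poly Sr.
Proof.
move=> Sa; rewrite horner_pole_poly => det0.
have Pu : pencil Sg a \in unitmx by rewrite unitmxE unitfE.
have [c [v [u [ca eB]]]] := right_tangent Sa.
have [d [w [r [da eC]]]] := left_tangent Sa Pu.
have [z] := tangential_defect eB eC.
rewrite -pencil_mx_galerkin -exprS => ez.
have numE : transfer_num Sr =
    (polycmx (so_C Sg) *m polycmx Pi *m \adj (pencil_mx Sr) *m
     (polycmx Ups *m polycmx (so_B Sg))) 0 0.
  by rewrite /transfer_num /cmx /= !map_mxM.
(* d c is nonzero at a, hence coprime to X - a, so multiplying by it does not affect the
   divisibility. *)
rewrite -dvdpNr opprB -(@Gauss_dvdpr _ _ (d * c)); last first.
  apply: coprimep_expl; rewrite coprimep_sym coprimep_XsubC /root hornerM.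
  exact: mulf_neq0.
by rewrite numE ez dvdp_mulIl.
Qed.


(** Invertible [U] and [V] leave the transfer function unchanged off the poles, so the numerator and
    [pole_poly] of the inner projection represent it. A point that is no pole of [Sr] is no pole of
    the inner projection either. *)
Lemma matches_moments_galerkin (U V : 'M[R]_k)
    (Sr := galerkin (galerkin Sg Ups Pi) U V) :
  U \in unitmx -> V \in unitmx ->
  spectrum S `&` poles Sg = set0 -> spectrum S `&` poles Sr = set0 ->
  matches_moments S (transfer Sr) (transfer Sg) /\
  matches_moments S (derivative (transfer Sr)) (derivative (transfer Sg)).
Proof.
move=> Uu Vu disj disjr.
have key a j : a \in spectrum S -> (j < mup a (char_poly (cmx S)))%N ->
    moment (transfer Sr) j a = moment (transfer Sg) j a /\
    moment (derivative (transfer Sr)) j a = moment (derivative (transfer Sg)) j a.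
  move=> Sa ltj.
  have nonpole l (T : sosystem R l) :
      spectrum S `&` poles T = set0 -> (pole_poly T).[a] != 0.
    rewrite horner_pole_poly => disjT; apply/eqP => det0.
    by have : set0 a; [rewrite -disjT; split=> //; exact/set_mem|].
  apply: (moment_ratio_eq (p1 := transfer_num (galerkin Sg Ups Pi))
    (q1 := pole_poly (galerkin Sg Ups Pi)) (p2 := transfer_num Sg)
    (q2 := pole_poly Sg) _ _ _ _ (transfer_diff_dvdp Sa _)) => //.
  - move=> s qs; rewrite transfer_galerkin_unit ?transfer_ratio //.
    by rewrite unitmxE unitfE -horner_pole_poly.
  - exact: pole_poly_galerkin (nonpole _ _ disjr).
  - by move=> s; exact: transfer_ratio.
  - exact: nonpole.
  - exact: nonpole.
by split=> a j Sa ltj; case: (key a j Sa ltj).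
Qed.

End TwoSided.
End Systems.

(** * The two families as projections, and their equivalence *)

(** Multiplying the Sylvester equation by [X] on the left shows that the F_0 prescribed by the
    family is X K Pi. *)
Lemma family_G_galerkin (R : realType) (n k : nat) (Sg : sosystem R n)
    (S : 'M[R]_k) (L : 'rV[R]_k) (Pi : 'M[R]_(n, k)) (X : 'M[R]_(k, n)) :
  so_M Sg *m Pi *m S ^+ 2 + so_D Sg *m Pi *m S + so_K Sg *m Pi =
    so_B Sg *m L ->
  family_G Sg S L Pi (X *m so_D Sg *m Pi) (X *m so_M Sg *m Pi) (X *m so_B Sg) =
    galerkin Sg X Pi.
Proof.
move=> sylv; rewrite /family_G /galerkin; congr SOSystem.
rewrite -(mulmxA X (so_B Sg)) -sylv !mulmxDr !mulmxA.
by rewrite -[LHS]addrA -opprD [X in X - _]addrC addrK.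
Qed.

Lemma family_H_galerkin (R : realType) (n k : nat) (Sg : sosystem R n)
    (S : 'M[R]_k) (L : 'rV[R]_k) (Ups : 'M[R]_(k, n)) (Y : 'M[R]_(n, k)) :
  S ^+ 2 *m Ups *m so_M Sg + S *m Ups *m so_D Sg + Ups *m so_K Sg =
    - (L^T *m so_C Sg) ->
  family_H Sg S L Ups (Ups *m so_D Sg *m Y) (Ups *m so_M Sg *m Y) (so_C Sg *m Y) =
    galerkin Sg Ups Y.
Proof.
move=> sylv; rewrite /family_H /galerkin; congr SOSystem.
rewrite (mulmxA L^T) -mulNmx -sylv !mulmxDl !mulmxA.
by rewrite -[LHS]addrA -opprD [X in X - _]addrC addrK.
Qed.

Lemma galerkin_comp (R : realType) (n k l : nat) (Sg : sosystem R n)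
    (U : 'M[R]_(k, n)) (V : 'M[R]_(n, k)) (U' : 'M[R]_(l, k)) (V' : 'M[R]_(k, l)) :
  galerkin (galerkin Sg U V) U' V' = galerkin Sg (U' *m U) (V *m V').
Proof. by rewrite /galerkin /= !mulmxA. Qed.

Theorem theorem6 (R : realType) (n nu : nat) (lt_nu_n : (nu < n)%N)
    (M D K : 'M[R]_n) (B : 'cV[R]_n) (C : 'rV[R]_n)
    (S : 'M[R]_nu) (L : 'rV[R]_nu)
    (Pi : 'M[R]_(n, nu)) (Ups : 'M[R]_(nu, n)) :
  let Sg := SOSystem M D K B C in
  let W := transfer Sg in
  pole_count Sg (2 * n) ->
  observable L S ->
  spectrum S `&` poles Sg = set0 ->
  M *m Pi *m S ^+ 2 + D *m Pi *m S + K *m Pi = B *m L ->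
  S ^+ 2 *m Ups *m M + S *m Ups *m D + Ups *m K = - (L^T *m C) ->
  Ups *m Pi \in unitmx ->
  let Pid := invmx (Ups *m Pi) *m Ups in
  let Upsd := Pi *m invmx (Ups *m Pi) in
  let SgG := family_G Sg S L Pi (Pid *m D *m Pi) (Pid *m M *m Pi) (Pid *m B) in
  let SgH :=
    family_H Sg S L Ups (Ups *m D *m Upsd) (Ups *m M *m Upsd) (C *m Upsd) in
  pole_count SgG (2 * nu) -> spectrum S `&` poles SgG = set0 ->
  pole_count SgH (2 * nu) -> spectrum S `&` poles SgH = set0 ->
  [/\ matches_moments S (transfer SgG) W /\
      matches_moments S (derivative (transfer SgG)) (derivative W)
    , matches_moments S (transfer SgH) W /\
      matches_moments S (derivative (transfer SgH)) (derivative W)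
    & equivalent SgG SgH].
Proof.
move=> Sg W _ obs disj sylvPi sylvUps Tu Pid Upsd SgG SgH _ disjG _ disjH.
(* Both models come from the projection by [Ups] and [Pi]; the inverse of Ups Pi acts on the left
   for [SgG] and on the right for [SgH]. *)
have SgGE : SgG = galerkin (galerkin Sg Ups Pi) (invmx (Ups *m Pi)) 1%:M.
  by rewrite galerkin_comp mulmx1; exact: (family_G_galerkin (Sg := Sg)).
have SgHE : SgH = galerkin (galerkin Sg Ups Pi) 1%:M (invmx (Ups *m Pi)).
  by rewrite galerkin_comp mul1mx; exact: (family_H_galerkin (Sg := Sg)).
have matches := matches_moments_galerkin (Sg := Sg) obs sylvPi sylvUps Tu.
split.
- by rewrite SgGE; apply: matches => //; rewrite ?unitmx_inv ?unitmx1 // -SgGE.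
- by rewrite SgHE; apply: matches => //; rewrite ?unitmx_inv ?unitmx1 // -SgHE.
(* T = Ups Pi cancels the inverse on the left and puts it on the right. *)
have SgHGE : SgH = galerkin SgG (Ups *m Pi) (invmx (Ups *m Pi)).
  by rewrite SgGE SgHE !galerkin_comp !mulmxA mulmxV // mul1mx mulmx1.
by rewrite SgHGE; exists (Ups *m Pi).
Qed.
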